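(* Let $\Gamma$ be a group that is nilpotent of class $\le n$, let $S\subseteq\Gamma\setminus\{\mathbb{I}\}$ be a generating set, $G:=\mathrm{Cay}(\Gamma,S)$, and let $r\ge\max\{2^{n+2},10\}$ be an integer. Let $h\in S$ be such that $\{\mathbb{I},h\}$ is an $r$-local $2$-separator of $G$, and suppose that $G$ has no $r$-local cutvertex. If $h$ is an involution, then the subgroup of $\Gamma$ generated by $h$ is normal.
   Context: Generating sets are closed under inverses; $\mathrm{Cay}(\Gamma,S)$ is the simple graph on $\Gamma$ with edges $\{g,gs\}$. $a\equiv b$ means $a=b$ or $a=b^{-1}$; $\Gamma$ is nilpotent of class $\le n$ if $[g,h]_n=\mathbb{I}$ for all $g\not\equiv h$, where $[g,h]_1=gh^{-1}g^{-1}h$ and $[g,h]_n$ is the reduced form of $g[g,h]_{n-1}^{-1}g^{-1}[g,h]_{n-1}$. Ball $B_r(v)$: subgraph of all vertices and edges on closed walks of length $\le r$ through $v$; $v$ is an $r$-local cutvertex if $B_r(v)-v$ is disconnected. For $X=\{v_0,v_1\}$, $N(X)$ is the set of vertices outside $X$ adjacent to $X$; the connectivity graph $C_r(v_0,v_1)$ has vertex set $N(X)$, $a,b$ adjacent if for some $i$ they lie in the same component of $B_r(v_i)-v_0-v_1$; $X$ is an $r$-local $2$-separator if $C_r(v_0,v_1)$ is disconnected and $d_G(v_0,v_1)\le r/2$. *)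

(* Defs.v *)
From Stdlib Require Import List Arith Relations.
Import ListNotations.

Record group := Group {
  carrier :> Type;
  gmul : carrier -> carrier -> carrier;
  ginv : carrier -> carrier;
  gone : carrier;
  gmulA : forall x y z, gmul x (gmul y z) = gmul (gmul x y) z;
  gmul1l : forall x, gmul gone x = x;
  gmulVl : forall x, gmul (ginv x) x = gone }.

Arguments gmul {g}.
Arguments ginv {g}.
Arguments gone {g}.

Inductive generated {Gm : group} (A : Gm -> Prop) : Gm -> Prop :=
| gen_in : forall x, A x -> generated A x
| gen_one : generated A gone
| gen_mul : forall x y, generated A x -> generated A y -> generated A (gmul x y)
| gen_inv : forall x, generated A x -> generated A (ginv x).

Definition normal {Gm : group} (H : Gm -> Prop) : Prop :=
  forall g x, H x -> H (gmul (gmul g x) (ginv g)).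

Definition gequiv {Gm : group} (a b : Gm) : Prop := a = b \/ a = ginv b.

(* comm_iter g h k = [g,h]_{k+1}:
   [g,h]_1 = g h^{-1} g^{-1} h,  [g,h]_m = g [g,h]_{m-1}^{-1} g^{-1} [g,h]_{m-1} *)
Fixpoint comm_iter {Gm : group} (g h : Gm) (k : nat) : Gm :=
  match k with
  | 0 => gmul (gmul (gmul g (ginv h)) (ginv g)) h
  | S k' => let c := comm_iter g h k' in
            gmul (gmul (gmul g (ginv c)) (ginv g)) c
  end.

(* nilpotent of class <= n (n >= 1): [g,h]_n = 1 for all g ≢ h *)
Definition nilpotent_le (Gm : group) (n : nat) : Prop :=
  forall g h : Gm, ~ gequiv g h -> comm_iter g h (n - 1) = gone.

Definition generating_set {Gm : group} (S : Gm -> Prop) : Prop :=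
  (forall s, S s -> S (ginv s)) /\ (forall g, generated S g).

Definition involution {Gm : group} (h : Gm) : Prop :=
  gmul h h = gone /\ h <> gone.

Definition cay_adj {Gm : group} (S : Gm -> Prop) (x y : Gm) : Prop :=
  exists s, S s /\ y = gmul x s.

Section Graphs.
Variable T : Type.
Variable adj : T -> T -> Prop.

Fixpoint is_walk (l : list T) : Prop :=
  match l with
  | x :: ((y :: _) as t) => adj x y /\ is_walk t
  | _ => True
  end.

(* a closed walk of length (length l - 1) <= r through v *)
Definition short_closed_walk_through (r : nat) (v : T) (l : list T) : Prop :=
  is_walk l /\ l <> [] /\ hd v l = last l v /\ length l <= S r /\ In v l.

Definition ball_v (r : nat) (v x : T) : Prop :=
  exists l, short_closed_walk_through r v l /\ In x l.

Definition ball_e (r : nat) (v x y : T) : Prop :=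
  exists l, short_closed_walk_through r v l /\
    exists l1 l2, l = l1 ++ x :: y :: l2 \/ l = l1 ++ y :: x :: l2.

Definition ballm_v (r : nat) (v : T) (Z : T -> Prop) (x : T) : Prop :=
  ball_v r v x /\ ~ Z x.

Definition ballm_e (r : nat) (v : T) (Z : T -> Prop) (x y : T) : Prop :=
  ball_e r v x y /\ ~ Z x /\ ~ Z y.

Definition same_comp (r : nat) (v : T) (Z : T -> Prop) (a b : T) : Prop :=
  ballm_v r v Z a /\ ballm_v r v Z b /\
  clos_refl_trans T (ballm_e r v Z) a b.

Definition local_cutvertex (r : nat) (v : T) : Prop :=
  exists a b, ballm_v r v (fun z => z = v) a /\ ballm_v r v (fun z => z = v) b /\
    ~ clos_refl_trans T (ballm_e r v (fun z => z = v)) a b.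

Definition pairset (v0 v1 : T) (z : T) : Prop := z = v0 \/ z = v1.

Definition nbhd (v0 v1 : T) (a : T) : Prop :=
  ~ pairset v0 v1 a /\ exists x, pairset v0 v1 x /\ adj x a.

Definition conn_edge (r : nat) (v0 v1 : T) (a b : T) : Prop :=
  nbhd v0 v1 a /\ nbhd v0 v1 b /\
  exists vi, pairset v0 v1 vi /\ same_comp r vi (pairset v0 v1) a b.

Definition dist_le (x y : T) (d : nat) : Prop :=
  exists l, is_walk l /\ l <> [] /\ hd x l = x /\ hd y (rev l) = y
            /\ length l <= S d.

Definition local_2_separator (r : nat) (v0 v1 : T) : Prop :=
  (exists a b, nbhd v0 v1 a /\ nbhd v0 v1 b /\
     ~ clos_refl_trans T (conn_edge r v0 v1) a b)
  /\ exists d, dist_le v0 v1 d /\ 2 * d <= r.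

End Graphs.

(* Main.v *)
Require Import Defs.
From Stdlib Require Import List Arith Relations.
From Stdlib Require Import Lia Classical.
Import ListNotations.

(** Write [X = {1, h}] and call two neighbours of [X] similar if they lie in the
    same component of the connectivity graph.  A translate [gX] is an edge, so a
    short closed walk splits at the cosets [gX] as at cutvertices: among all returns
    of the walk to a coset already visited take a shortest one; then it enters and
    leaves every intermediate coset through similar neighbours, because the rest
    of the return is a short detour around that coset, and for the same reason it
    leaves the initial coset and comes back to it through similar neighbours.

    Since [h] is an involution, [[h,g]_n = (h g^-1 h g)^(2^(n-1))], so this word is a
    closed walk of length at most [r] whenever [g] is a product of at most three
    generators.  Taking [g = s] shows that [s] and [h s] are similar for every
    generator [s <> h].  If [t] is a generator not commuting with [h], then
    [g = t^2] shows that [t] and [t^-1] are similar, and [g = t u t^-1] that every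
    generator [u <> h] is similar to [t].  Hence the connectivity graph would be
    connected; so [h] commutes with all generators. *)

(** * Groups *)

Section GroupLemmas.
Variable Gm : group.
Implicit Types x y z : Gm.

Lemma gmulKl x y : gmul (ginv x) (gmul x y) = y.
Proof. now rewrite gmulA, gmulVl, gmul1l. Qed.

Lemma gmulVr x : gmul x (ginv x) = gone.
Proof.
  rewrite <- (gmulKl (ginv x) (gmul x (ginv x))), (gmulKl x).
  apply gmulVl.
Qed.

Lemma gmul1r x : gmul x gone = x.
Proof. now rewrite <- (gmulVl _ x), gmulA, gmulVr, gmul1l. Qed.

Lemma gmulKr x y : gmul x (gmul (ginv x) y) = y.
Proof. now rewrite gmulA, gmulVr, gmul1l. Qed.

Lemma gmul_injl x y z : gmul x y = gmul x z -> y = z.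
Proof. intros H. now rewrite <- (gmulKl x y), H, gmulKl. Qed.

Lemma gmul_injr x y z : gmul y x = gmul z x -> y = z.
Proof.
  intros H. rewrite <- (gmul1r y), <- (gmul1r z), <- (gmulVr x), !gmulA.
  now rewrite H.
Qed.

Lemma ginvK x : ginv (ginv x) = x.
Proof. apply (gmul_injl (ginv x)). now rewrite gmulVr, gmulVl. Qed.

Lemma ginvM x y : ginv (gmul x y) = gmul (ginv y) (ginv x).
Proof.
  apply (gmul_injl (gmul x y)). rewrite gmulVr, <- gmulA.
  now rewrite gmulKr, gmulVr.
Qed.

Lemma ginv1 : ginv (@gone Gm) = gone.
Proof. rewrite <- (gmul1l _ (ginv gone)). apply gmulVr. Qed.

Definition gpow x (k : nat) : Gm := Nat.iter k (fun y => gmul y x) gone.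

Lemma gpowD x a b : gpow x (b + a) = gmul (gpow x a) (gpow x b).
Proof.
  induction b as [|b IH]; simpl; [now rewrite gmul1r|].
  unfold gpow in *. now rewrite IH, gmulA.
Qed.

Lemma gpow1n k : gpow gone k = gone.
Proof. induction k as [|k IH]; [easy|]. simpl. now rewrite gmul1r. Qed.

End GroupLemmas.

Hint Rewrite <- gmulA : grp.
Hint Rewrite gmul1l gmul1r gmulVl gmulVr gmulKl gmulKr ginvM ginvK ginv1 : grp.

(** * Short excursions from a pair of vertices *)

Section GraphLemmas.
Variable T : Type.
Variable adj : T -> T -> Prop.
Hypothesis adj_sym : forall x y, adj x y -> adj y x.

Lemma clos_refl_trans_sym (R : T -> T -> Prop) :
  (forall x y, R x y -> R y x) ->
  forall x y, clos_refl_trans T R x y -> clos_refl_trans T R y x.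
Proof.
  intros HR x y H. induction H; [now apply rt_step, HR|apply rt_refl|].
  eapply rt_trans; eassumption.
Qed.

Lemma ballm_e_sym r v Z x y : ballm_e T adj r v Z x y -> ballm_e T adj r v Z y x.
Proof.
  intros [[l [Hl [l1 [l2 H]]]] [Hx Hy]]. repeat split; trivial.
  exists l. split; trivial. exists l1, l2. tauto.
Qed.

Lemma conn_edge_sym r v0 v1 x y :
  conn_edge T adj r v0 v1 x y -> conn_edge T adj r v0 v1 y x.
Proof.
  intros [Hx [Hy [v [Hv [H1 [H2 H3]]]]]]. split; [easy|]. split; [easy|].
  exists v. split; [easy|]. split; [easy|]. split; [easy|].
  apply clos_refl_trans_sym; [|exact H3]. intros; now apply ballm_e_sym.
Qed.

Lemma segment_head_connected r v Z p :
  forall l l1 l2 a b, short_closed_walk_through T adj r v l ->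
  l = l1 ++ (a :: p) ++ l2 -> (forall z, In z (a :: p) -> ~ Z z) ->
  In b (a :: p) -> clos_refl_trans T (ballm_e T adj r v Z) a b.
Proof.
  induction p as [|c p IH]; intros l l1 l2 a b Hl El HZ [<-|Hb];
    try apply rt_refl; [easy|].
  apply rt_trans with c.
  - apply rt_step. split; [|split; apply HZ; simpl; auto].
    exists l. split; [easy|]. exists l1, (p ++ l2). now left.
  - apply (IH l (l1 ++ [a]) l2); auto.
    + rewrite El. now rewrite <- app_assoc.
    + intros z Hz. apply HZ. now right.
Qed.

Lemma segment_connected r v Z l l1 p l2 a b :
  short_closed_walk_through T adj r v l ->
  l = l1 ++ p ++ l2 -> (forall z, In z p -> ~ Z z) ->
  In a p -> In b p -> clos_refl_trans T (ballm_e T adj r v Z) a b.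
Proof.
  intros Hl El HZ Ha Hb. destruct p as [|c p]; [easy|].
  apply rt_trans with c.
  - apply clos_refl_trans_sym; [intros; now apply ballm_e_sym|].
    eapply segment_head_connected; eassumption.
  - eapply segment_head_connected; eassumption.
Qed.

Lemma is_walk_app l1 x l2 :
  is_walk T adj (l1 ++ [x]) -> is_walk T adj (x :: l2) ->
  is_walk T adj (l1 ++ x :: l2).
Proof.
  induction l1 as [|a [|b l1] IH]; intros H1 H2; [easy| |].
  - split; [apply H1|exact H2].
  - destruct H1 as [Hab H1]. split; [exact Hab|]. now apply IH.
Qed.

(** When the ends differ, the edge between [v0] and [v1] closes the walk, at the cost of one more
    edge. The closed walk passes through [v], so [p] lies in the ball around [v]; as [p] avoids the
    pair, it stays within one component. *)
Lemma excursion_conn_edge r v0 v1 v v' p a b :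
  adj v0 v1 ->
  is_walk T adj (v :: p ++ [v']) ->
  pairset T v0 v1 v -> pairset T v0 v1 v' ->
  (forall z, In z p -> ~ pairset T v0 v1 z) ->
  (v = v' /\ length p + 1 <= r \/ length p + 2 <= r) ->
  In a p -> In b p ->
  (exists x, pairset T v0 v1 x /\ adj x a) ->
  (exists x, pairset T v0 v1 x /\ adj x b) ->
  conn_edge T adj r v0 v1 a b.
Proof.
  intros H01 Hw Hv Hv' HZ Hlen Ha Hb Na Nb.
  assert (Hl : exists l l2, short_closed_walk_through T adj r v l /\
                            l = [v] ++ p ++ l2).
  { destruct (classic (v = v')) as [<-|Hne].
    - exists (v :: p ++ [v]), [v]. split; [|easy]. repeat split; try easy.
      + rewrite app_comm_cons, last_last. easy.
      + simpl. rewrite length_app. simpl. lia.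
      + now left.
    - exists (v :: p ++ [v'; v]), [v'; v]. split; [|easy]. repeat split; try easy.
      + rewrite app_comm_cons. apply is_walk_app; [exact Hw|].
        split; [|easy].
        destruct Hv as [-> | ->], Hv' as [-> | ->]; try easy; auto.
      + change [v'; v] with ([v'] ++ [v]).
        rewrite app_assoc, app_comm_cons, last_last. easy.
      + simpl. rewrite length_app. simpl. destruct Hlen; [easy|lia].
      + now left. }
  destruct Hl as [l [l2 [Hl El]]].
  assert (Hin : forall z, In z p -> ballm_v T adj r v (pairset T v0 v1) z).
  { intros z Hz. split; [|now apply HZ]. exists l. split; [easy|].
    rewrite El. apply in_or_app. right. apply in_or_app. now left. }
  split; [split; auto|]. split; [split; auto|].
  exists v. split; [easy|]. split; [auto|]. split; [auto|].
  eapply segment_connected; eassumption.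
Qed.

End GraphLemmas.

(** * Translates of the pair in the Cayley graph *)

Section CayleyWalks.
Variable Gm : group.
Variable Gen : Gm -> Prop.
Variable r : nat.
Variable h : Gm.
Hypothesis Gen_inv : forall s, Gen s -> Gen (ginv s).
Hypothesis Gen_ne1 : ~ Gen gone.
Hypothesis Gen_h : Gen h.
Hypothesis hh : gmul h h = gone.

Notation X := (pairset Gm gone h).
Notation sim := (clos_refl_trans Gm (conn_edge Gm (cay_adj Gen) r gone h)).

Lemma hV : ginv h = h.
Proof. apply (gmul_injl _ h). now rewrite gmulVr. Qed.

Lemma hhK x : gmul h (gmul h x) = x.
Proof. now rewrite gmulA, hh, gmul1l. Qed.

Ltac gnorm := repeat (progress autorewrite with grp || rewrite hV || rewrite hh || rewrite hhK).
Ltac gnorm_in H :=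
  repeat (progress autorewrite with grp in H || rewrite hV in H || rewrite hh in H || rewrite hhK in H).

Lemma cay_adj_sym x y : cay_adj Gen x y -> cay_adj Gen y x.
Proof.
  intros [s [Hs ->]]. exists (ginv s). split; [auto|]. now gnorm.
Qed.

Lemma cay_adj_mull g x y : cay_adj Gen x y -> cay_adj Gen (gmul g x) (gmul g y).
Proof. intros [s [Hs ->]]. exists s. split; [auto|]. now gnorm. Qed.

Lemma is_walk_mull g l :
  is_walk Gm (cay_adj Gen) l -> is_walk Gm (cay_adj Gen) (map (gmul g) l).
Proof.
  induction l as [|x [|y l] IH]; try easy. intros [H1 H2].
  split; [now apply cay_adj_mull|now apply IH].
Qed.

Lemma sim_sym x y : sim x y -> sim y x.
Proof. apply clos_refl_trans_sym, conn_edge_sym. Qed.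

Lemma X_mul x y : X x -> X y -> X (gmul x y).
Proof. intros [-> | ->] [-> | ->]; gnorm; unfold pairset; auto. Qed.

Lemma X_inv x : X x -> X (ginv x).
Proof. intros [-> | ->]; gnorm; unfold pairset; auto. Qed.

(** Since [h] squares to the identity, [X] is a subgroup; the classes of this relation are its left
    cosets. *)
Definition same_coset x y := X (gmul (ginv x) y).

Lemma same_coset_refl x : same_coset x x.
Proof. left. now gnorm. Qed.

Lemma same_coset_sym x y : same_coset x y -> same_coset y x.
Proof. intros H. apply X_inv in H. now gnorm_in H. Qed.

Lemma same_coset_trans y x z : same_coset x y -> same_coset y z -> same_coset x z.
Proof. intros H1 H2. generalize (X_mul _ _ H1 H2). now gnorm. Qed.

(** Left translation by [ginv g] is an automorphism of the Cayley graph carrying the coset of [g] to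
    [X], where [excursion_conn_edge] applies. *)
Lemma excursion_sim g v v' p a b :
  is_walk Gm (cay_adj Gen) (v :: p ++ [v']) ->
  same_coset g v -> same_coset g v' ->
  (forall z, In z p -> ~ same_coset g z) ->
  (v = v' /\ length p + 1 <= r \/ length p + 2 <= r) ->
  In a p -> In b p ->
  (exists x, same_coset g x /\ cay_adj Gen x a) ->
  (exists x, same_coset g x /\ cay_adj Gen x b) ->
  sim (gmul (ginv g) a) (gmul (ginv g) b).
Proof.
  intros Hw Hv Hv' HZ Hlen Ha Hb [x [Hx Na]] [y [Hy Nb]]. apply rt_step.
  apply (excursion_conn_edge _ _ cay_adj_sym r gone h (gmul (ginv g) v)
           (gmul (ginv g) v') (map (gmul (ginv g)) p)); auto.
  - exists h. now rewrite gmul1l.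
  - apply (is_walk_mull (ginv g)) in Hw. simpl in Hw. now rewrite map_app in Hw.
  - intros z Hz. apply in_map_iff in Hz. destruct Hz as [u [<- Hu]]. now apply HZ.
  - rewrite length_map. destruct Hlen as [[-> H]|H]; auto.
  - now apply in_map.
  - now apply in_map.
  - exists (gmul (ginv g) x). split; [easy|now apply cay_adj_mull].
  - exists (gmul (ginv g) y). split; [easy|now apply cay_adj_mull].
Qed.

(** * Minimal returns to a coset *)

(* A letter [(b, s)] stands for an optional [h]-edge (present iff [b]) followed
   by the edge [s]. *)
Definition opt_h (b : bool) : Gm := if b then h else gone.
Definition lval (c : bool * Gm) : Gm := gmul (opt_h (fst c)) (snd c).

Lemma opt_h_X b : X (opt_h b).
Proof. destruct b; [right|left]; easy. Qed.

Section Word.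
Variable w : nat -> bool * Gm.

Fixpoint pos (k : nat) : Gm :=
  match k with 0 => gone | S k' => gmul (pos k') (lval (w k')) end.

Definition block (k : nat) : list Gm :=
  pos k :: if fst (w k) then [gmul (pos k) h] else [].

(** The end vertex [pos (d + a)] is left out, so the length of the list is the number of edges of
    the walk. *)
Fixpoint trail (a d : nat) : list Gm :=
  match d with 0 => [] | S d' => block a ++ trail (S a) d' end.

Lemma trail_app a d e : trail a (d + e) = trail a d ++ trail (d + a) e.
Proof.
  revert a. induction d as [|d IH]; intros a; [easy|].
  cbn [trail Nat.add]. rewrite IH, app_assoc.
  now replace (d + S a) with (S (d + a)) by lia.
Qed.

Lemma in_trail z a d :
  In z (trail a d) -> exists k, a <= k < d + a /\ same_coset (pos k) z.
Proof.
  revert a. induction d as [|d IH]; intros a H; [easy|].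
  cbn [trail] in H. apply in_app_or in H. destruct H as [H|H].
  - exists a. split; [lia|]. destruct H as [<-|H]; [apply same_coset_refl|].
    destruct (fst (w a)); [|easy]. destruct H as [<-|[]].
    right. now gnorm.
  - destruct (IH _ H) as [k [Hk H']]. exists k. split; [lia|easy].
Qed.

Lemma in_trail_pos k a d : a <= k < d + a -> In (pos k) (trail a d).
Proof.
  revert a. induction d as [|d IH]; intros a H; [lia|].
  cbn [trail]. destruct (Nat.eq_dec k a) as [->|Hne]; [now left|].
  apply in_or_app. right. apply IH. lia.
Qed.

Lemma in_trail_opt_h k a d :
  a <= k < d + a -> In (gmul (pos k) (opt_h (fst (w k)))) (trail a d).
Proof.
  revert a. induction d as [|d IH]; intros a H; [lia|].
  cbn [trail]. apply in_or_app.
  destruct (Nat.eq_dec k a) as [->|Hne]; [left|right; apply IH; lia].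
  unfold block. destruct (fst (w a)); simpl; gnorm; auto.
Qed.

Hypothesis w_Gen : forall k, Gen (snd (w k)).

Lemma walk_block a l :
  is_walk Gm (cay_adj Gen) (pos (S a) :: l) ->
  is_walk Gm (cay_adj Gen) (block a ++ pos (S a) :: l).
Proof.
  intros H. unfold block. cbn [pos] in *. unfold lval in *.
  destruct (fst (w a)); simpl.
  - split; [now exists h|]. split; [|exact H].
    exists (snd (w a)). split; [auto|]. now gnorm.
  - split; [|exact H]. exists (snd (w a)). split; [auto|]. now gnorm.
Qed.

Lemma walk_trail a d l :
  is_walk Gm (cay_adj Gen) (pos (d + a) :: l) ->
  is_walk Gm (cay_adj Gen) (trail a d ++ pos (d + a) :: l).
Proof.
  revert a. induction d as [|d IH]; intros a H; [exact H|].
  cbn [trail]. rewrite <- app_assoc.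
  replace (S d + a) with (d + S a) in * by lia.
  specialize (IH _ H).
  destruct d as [|d]; [now apply walk_block|].
  cbn [trail] in *. unfold block at 2. unfold block at 1 in IH. simpl in *.
  now apply walk_block.
Qed.

Lemma walk_drop_block a l :
  is_walk Gm (cay_adj Gen) (block a ++ l) ->
  is_walk Gm (cay_adj Gen) (gmul (pos a) (opt_h (fst (w a))) :: l).
Proof.
  unfold block, opt_h. destruct (fst (w a)); simpl; gnorm; [|easy].
  now intros [_ H].
Qed.

Lemma cay_adj_depart k :
  cay_adj Gen (gmul (pos k) (opt_h (fst (w k)))) (pos (S k)).
Proof. exists (snd (w k)). split; [auto|]. simpl. unfold lval. now gnorm. Qed.

Lemma same_coset_depart k : same_coset (pos k) (gmul (pos k) (opt_h (fst (w k)))).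
Proof. unfold same_coset. gnorm. apply opt_h_X. Qed.

Lemma length_block a : length (block a) = if fst (w a) then 2 else 1.
Proof. unfold block. now destruct (fst (w a)). Qed.

(* The cyclic walk through the return, cut open at the coset of [pos (S (e + i))],
   is the detour; closing it may need one extra [h]-edge from [pos (d + i)] to
   [pos i]. *)
Lemma passage_noncrossing i e f :
  let d := e + 2 + f in
  same_coset (pos i) (pos (d + i)) ->
  (forall a c, i <= a -> 0 < c -> c < d -> c + a <= d + i ->
     ~ same_coset (pos a) (pos (c + a))) ->
  length (trail i d) <= r ->
  (pos (d + i) = pos i \/ length (trail i d) + 1 <= r) ->
  sim (ginv (snd (w (e + i)))) (lval (w (S (e + i)))).
Proof.
  intros d Hc Hmin Hlen Hlen'.
  set (k := e + i).
  (* By minimality the coset of [pos (S k)] is visited at no other index of the return. *)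
  assert (Havoid : forall l z, i <= l <= d + i -> l <> S k ->
             same_coset (pos l) z -> ~ same_coset (pos (S k)) z).
  { intros l z Hl Hne Hz Hz'.
    assert (H : same_coset (pos l) (pos (S k))).
    { apply same_coset_trans with z; [easy|now apply same_coset_sym]. }
    destruct (Nat.lt_ge_cases l (S k)) as [Hlt|Hge].
    - apply (Hmin l (S k - l)); try (unfold k, d in *; lia).
      now replace (S k - l + l) with (S k) by lia.
    - apply (Hmin (S k) (l - S k)); try (unfold k, d in *; lia).
      replace (l - S k + S k) with l by lia.
      now apply same_coset_sym. }
  assert (Htr : trail i d =
     trail i (S e) ++ block (S k) ++ trail (2 + k) f).
  { unfold d. replace (e + 2 + f) with (S e + (1 + f)) by lia.
    now rewrite trail_app. }
  rewrite Htr, !length_app, length_block in Hlen, Hlen'.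
  (* [mid] is empty if the return closes up, and otherwise the single vertex [pos (d + i)], joined
     to [pos i] by an [h]-edge that [Hlen'] pays for. *)
  assert (Hmid : exists mid R,
     mid ++ trail i (S e) ++ [pos (S k)] = pos (d + i) :: R /\
     is_walk Gm (cay_adj Gen) (pos (d + i) :: R) /\
     (forall z, In z mid -> z = pos (d + i)) /\
     In (pos (d + i)) (mid ++ trail i (S e)) /\
     length mid + length (trail i (S e)) + (if fst (w (S k)) then 2 else 1)
       + length (trail (2 + k) f) <= r).
  { assert (HR : is_walk Gm (cay_adj Gen) (trail i (S e) ++ [pos (S k)])).
    { apply (walk_trail i (S e) []). easy. }
    assert (Hi : In (pos i) (trail i (S e))) by (apply in_trail_pos; lia).
    destruct (classic (pos (d + i) = pos i)) as [E|E].
    - exists [], (tl (trail i (S e) ++ [pos (S k)])).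
      rewrite E. simpl in *. repeat split; auto; try easy. lia.
    - exists [pos (d + i)], (trail i (S e) ++ [pos (S k)]).
      repeat split; auto.
      + apply cay_adj_sym.
        exists h. split; [easy|]. destruct Hc as [Hc|Hc].
        * exfalso. apply E. apply (gmul_injl _ (ginv (pos i))).
          now rewrite Hc, gmulVl.
        * rewrite <- Hc. now gnorm.
      + now intros z [<-|[]].
      + now left.
      + destruct Hlen' as [?|Hlen']; [easy|]. simpl length at 1. lia. }
  destruct Hmid as [mid [R [ER [HR [Hmid [HR' Hlen2]]]]]].
  set (p := trail (2 + k) f ++ mid ++ trail i (S e)).
  replace (lval (w (S k)))
    with (gmul (ginv (pos (S k))) (pos (2 + k))) by (simpl; now gnorm).
  replace (ginv (snd (w k))) with
    (gmul (ginv (pos (S k))) (gmul (pos k) (opt_h (fst (w k)))))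
    by (simpl; unfold lval; now gnorm).
  (* The detour leads from where the walk leaves the coset of [pos (S k)] round to [pos (S k)].
     These ends differ only if the letter has an [h]-edge; then [block (S k)] has length two, which
     covers the closing edge. *)
  apply (excursion_sim _ (gmul (pos (S k)) (opt_h (fst (w (S k)))))
           (pos (S k)) p).
  - apply walk_drop_block. unfold p. rewrite <- !app_assoc, ER.
    change (is_walk Gm (cay_adj Gen) (block (S k) ++ trail (2 + k) f ++ pos (d + i) :: R)).
    rewrite app_assoc.
    change (block (S k) ++ trail (2 + k) f) with (trail (S k) (S f)).
    replace (d + i) with (S f + S k) in * by (unfold d, k; lia).
    now apply walk_trail.
  - apply same_coset_depart.
  - apply same_coset_refl.
  - intros z Hz. unfold p in Hz. rewrite !in_app_iff in Hz.
    destruct Hz as [Hz|[Hz|Hz]].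
    + destruct (in_trail _ _ _ Hz) as [l [Hl Hz']].
      apply (Havoid l); auto; unfold d, k in *; lia.
    + apply Hmid in Hz. subst z. apply (Havoid (d + i)).
      * lia.
      * unfold d, k; lia.
      * apply same_coset_refl.
    + destruct (in_trail _ _ _ Hz) as [l [Hl Hz']].
      apply (Havoid l); auto; unfold d, k in *; lia.
  - unfold p. rewrite !length_app.
    destruct (fst (w (S k))); [right; lia|left].
    simpl opt_h. gnorm. split; [easy|lia].
  - unfold p. rewrite !in_app_iff. right; right. apply in_trail_opt_h. unfold k; lia.
  (* After the last passage the successor is the end of the return, which is in [mid] or equals
     [pos i]. *)
  - unfold p. apply in_or_app. destruct f as [|f].
    + right. now replace (2 + k) with (d + i) by (unfold d, k; lia).
    + left. apply in_trail_pos. lia.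
  - exists (pos (S k)). split; [apply same_coset_refl|].
    apply cay_adj_sym, cay_adj_depart.
  - exists (gmul (pos (S k)) (opt_h (fst (w (S k))))).
    split; [apply same_coset_depart|apply cay_adj_depart].
Qed.

(** The detour is now the return without its first block: by minimality its interior avoids the
    coset of [pos i]. The two similar elements are the first vertex after departure and the last
    before arrival, translated by [ginv (pos i)]. *)
Lemma return_same_side i f :
  let d := 2 + f in
  same_coset (pos i) (pos (d + i)) ->
  (forall a c, i <= a -> 0 < c -> c < d -> c + a <= d + i ->
     ~ same_coset (pos a) (pos (c + a))) ->
  length (trail i d) <= r ->
  (pos (d + i) = pos i \/ length (trail i d) + 1 <= r) ->
  sim (lval (w i))
    (gmul (gmul (ginv (pos i)) (pos (d + i))) (ginv (snd (w (S f + i))))).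
Proof.
  intros d Hc Hmin Hlen Hlen'.
  replace (lval (w i)) with (gmul (ginv (pos i)) (pos (S i)))
    by (simpl; now gnorm).
  replace (gmul (gmul (ginv (pos i)) (pos (d + i))) (ginv (snd (w (S f + i)))))
    with (gmul (ginv (pos i))
            (gmul (pos (S f + i)) (opt_h (fst (w (S f + i))))))
    by (simpl; unfold lval; now gnorm).
  assert (Htr : trail i d = block i ++ trail (S i) (S f)) by easy.
  rewrite Htr, !length_app, length_block in Hlen, Hlen'.
  apply (excursion_sim _ (gmul (pos i) (opt_h (fst (w i)))) (pos (d + i))
           (trail (S i) (S f))).
  - apply walk_drop_block. rewrite app_assoc, <- Htr.
    apply (walk_trail i d []). easy.
  - apply same_coset_depart.
  - easy.
  - intros z Hz Hz'. destruct (in_trail _ _ _ Hz) as [l [Hl Hz2]].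
    apply (Hmin i (l - i)); try (unfold d in *; lia).
    replace (l - i + i) with l by lia.
    apply same_coset_trans with z; [easy|now apply same_coset_sym].
  - destruct (fst (w i)); [right; lia|].
    destruct Hlen' as [->|Hlen']; [left|right; lia].
    simpl opt_h. gnorm. split; [easy|lia].
  - apply in_trail_pos. lia.
  - apply in_trail_opt_h. lia.
  - exists (gmul (pos i) (opt_h (fst (w i)))).
    split; [apply same_coset_depart|apply cay_adj_depart].
  - exists (pos (d + i)). split; [easy|]. apply cay_adj_sym, cay_adj_depart.
Qed.

Hypothesis w_h : forall k, snd (w k) <> h.

(** Excludes returns made of a single letter. *)
Lemma lval_notin_X k : ~ X (lval (w k)).
Proof.
  intros H. assert (H' : X (snd (w k))).
  { generalize (X_mul _ _ (X_inv _ (opt_h_X (fst (w k)))) H). unfold lval. now gnorm. }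
  destruct H' as [H'|H'].
  - apply Gen_ne1. rewrite <- H'. apply w_Gen.
  - now apply (w_h k).
Qed.

Lemma closed_word_return m :
  0 < m -> pos m = gone -> length (trail 0 m) <= r ->
  exists i d, same_coset (pos i) (pos (2 + d + i)) /\
    (forall e, e <= d ->
       sim (ginv (snd (w (e + i)))) (lval (w (S (e + i))))) /\
    sim (lval (w i))
      (gmul (gmul (ginv (pos i)) (pos (2 + d + i)))
            (ginv (snd (w (S d + i))))).
Proof.
  intros Hm Hclosed Hlen.
  (* A shortest return over all starting points, found by descent from the whole word, which is
     itself a return. *)
  assert (Hex : exists d i, 0 < d /\ d + i <= m /\ same_coset (pos i) (pos (d + i)) /\
     forall a c, 0 < c -> c < d -> c + a <= m -> ~ same_coset (pos a) (pos (c + a))).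
  { assert (H : exists i, 0 < m /\ m + i <= m /\ same_coset (pos i) (pos (m + i))).
    { exists 0. rewrite Nat.add_0_r, Hclosed. repeat split; auto; try lia.
      apply same_coset_refl. }
    revert H. generalize m at 1 2 4. intros d.
    induction d as [d IH] using (well_founded_induction lt_wf). intros [i H].
    destruct (classic (exists c, c < d /\ exists a,
       0 < c /\ c + a <= m /\ same_coset (pos a) (pos (c + a)))) as [[c [Hc Ha]]|Hno].
    - now apply (IH c).
    - exists d, i. repeat split; try easy. intros a c Hc Hcd Ham Hs.
      apply Hno. exists c. split; [easy|]. now exists a. }
  destruct Hex as [d [i [Hd [Hdi [Hs Hmin]]]]].
  (* A proper return leaves out at least one letter, whose edge makes room for the closing [h]-edge;
     the whole word ends where it starts. *)
  assert (Hl1 : length (trail i d) <= r /\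
                (pos (d + i) = pos i \/ length (trail i d) + 1 <= r)).
  { assert (Hb : forall a c, c <= length (trail a c)).
    { intros a c. revert a. induction c as [|c IH]; intros a; [simpl; lia|].
      simpl. rewrite length_app. specialize (IH (S a)). simpl. lia. }
    replace m with (i + (d + (m - d - i))) in Hlen by lia.
    rewrite !trail_app, !length_app, Nat.add_0_r in Hlen.
    pose proof (Hb 0 i). pose proof (Hb (d + i) (m - d - i)).
    destruct (Nat.eq_dec d m) as [->|Hne].
    - assert (i = 0) as -> by lia. rewrite Nat.add_0_r in *. split; [lia|now left].
    - split; [lia|right; lia]. }
  destruct Hl1 as [Hl1 Hl2].
  destruct d as [|[|d]]; [lia| |].
  { exfalso. apply (lval_notin_X i). unfold same_coset in Hs. simpl in Hs.
    now gnorm_in Hs. }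
  exists i, d. split; [easy|]. split.
  - intros e He. apply (passage_noncrossing i e (d - e));
      replace (e + 2 + (d - e)) with (S (S d)) by lia; auto.
    intros; apply Hmin; lia.
  - apply return_same_side; auto. intros; apply Hmin; lia.
Qed.

End Word.

(** * Cyclic words *)

Definition rot {A : Type} (l : list A) : list A :=
  match l with [] => [] | x :: l' => l' ++ [x] end.

(** With this encoding a shift of the periodic sequence is a rotation of [L]. The default of [hd]
    occurs only for the empty list. *)
Definition cyc (L : list (bool * Gm)) (k : nat) : bool * Gm :=
  hd (false, gone) (Nat.iter k rot L).

Definition wprod (L : list (bool * Gm)) : Gm :=
  fold_right (fun c y => gmul (lval c) y) gone L.

Definition wcost (L : list (bool * Gm)) : nat :=
  fold_right (fun (c : bool * Gm) m => (if fst c then 2 else 1) + m) 0 L.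

Lemma iter_rot_app {A : Type} (l1 l2 : list A) :
  Nat.iter (length l1) rot (l1 ++ l2) = l2 ++ l1.
Proof.
  revert l2. induction l1 as [|x l1 IH]; intros l2; [now rewrite app_nil_r|].
  simpl length. rewrite Nat.iter_succ_r. simpl. rewrite <- app_assoc, IH.
  now rewrite <- app_assoc.
Qed.

Lemma iter_rot_period {A : Type} (L : list A) N :
  Nat.iter (N * length L) rot L = L.
Proof.
  induction N as [|N IH]; [easy|]. simpl. rewrite Nat.iter_add, IH.
  rewrite <- (app_nil_r L) at 2. now rewrite iter_rot_app.
Qed.

Lemma iter_rot_mod {A : Type} (L : list A) i :
  Nat.iter i rot L = Nat.iter (i mod length L) rot L.
Proof.
  replace (Nat.iter i rot L)
    with (Nat.iter (i mod length L + i / length L * length L) rot L).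
  - now rewrite Nat.iter_add, iter_rot_period.
  - f_equal. pose proof (Nat.div_mod_eq i (length L)). lia.
Qed.

Lemma in_iter_rot {A : Type} (L : list A) i x : In x (Nat.iter i rot L) -> In x L.
Proof.
  induction i as [|i IH]; [easy|]. simpl. intros H. apply IH.
  destruct (Nat.iter i rot L) as [|y l]; [easy|]. simpl in *.
  apply in_app_or in H. simpl in H. tauto.
Qed.

Lemma length_iter_rot {A : Type} (L : list A) i : length (Nat.iter i rot L) = length L.
Proof.
  induction i as [|i IH]; [easy|]. simpl. rewrite <- IH.
  destruct (Nat.iter i rot L); [easy|]. simpl. rewrite length_app. simpl. lia.
Qed.

Lemma in_cyc L k : L <> [] -> In (cyc L k) L.
Proof.
  intros HL. apply (in_iter_rot L k). unfold cyc.
  pose proof (length_iter_rot L k) as H.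
  destruct (Nat.iter k rot L); [|now left]. now destruct L.
Qed.

Lemma cyc_shift L i k : cyc (Nat.iter i rot L) k = cyc L (k + i).
Proof. unfold cyc. now rewrite Nat.iter_add. Qed.

Lemma pos_shift L i d :
  pos (cyc L) (d + i) = gmul (pos (cyc L) i) (pos (cyc (Nat.iter i rot L)) d).
Proof.
  induction d as [|d IH]; simpl; [now rewrite gmul1r|].
  now rewrite IH, cyc_shift, gmulA.
Qed.

Lemma pos_app l1 l2 : pos (cyc (l1 ++ l2)) (length l1) = wprod l1.
Proof.
  revert l2. induction l1 as [|x l1 IH]; intros l2; [easy|].
  simpl length. rewrite <- Nat.add_1_r, pos_shift. simpl Nat.iter.
  rewrite <- app_assoc, IH. simpl. unfold cyc. simpl. now rewrite gmul1l.
Qed.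

Lemma pos_period L N : pos (cyc L) (N * length L) = gpow _ (wprod L) N.
Proof.
  induction N as [|N IH]; [easy|]. simpl Nat.mul.
  rewrite pos_shift, iter_rot_period, IH. simpl.
  rewrite <- (app_nil_r L) at 2. now rewrite pos_app.
Qed.

Lemma length_trail_shift L i a d :
  length (trail (cyc L) (a + i) d) = length (trail (cyc (Nat.iter i rot L)) a d).
Proof.
  revert a. induction d as [|d IH]; intros a; [easy|].
  cbn [trail]. rewrite !length_app, !length_block, cyc_shift. f_equal. apply (IH (S a)).
Qed.

Lemma length_trail_app l1 l2 : length (trail (cyc (l1 ++ l2)) 0 (length l1)) = wcost l1.
Proof.
  revert l2. induction l1 as [|x l1 IH]; intros l2; [easy|].
  cbn [length trail]. rewrite length_app, length_block. simpl. f_equal.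
  rewrite (length_trail_shift _ 1 0). simpl. now rewrite <- app_assoc, IH.
Qed.

Lemma length_trail_period L N : length (trail (cyc L) 0 (N * length L)) = N * wcost L.
Proof.
  induction N as [|N IH]; [easy|]. simpl Nat.mul.
  rewrite Nat.add_comm, trail_app, length_app, IH, Nat.add_comm. f_equal.
  rewrite Nat.add_comm, length_trail_shift, iter_rot_period.
  rewrite <- (app_nil_r L) at 1. now rewrite length_trail_app.
Qed.

(** Rotations of [L] have period [length L], so the starting index can be reduced modulo it, and
    translation lets the return begin at the identity. A concrete word thus needs one case per
    letter. *)
Lemma cyclic_word_return L N :
  L <> [] -> 0 < N -> Forall (fun c => Gen (snd c) /\ snd c <> h) L ->
  gpow _ (wprod L) N = gone -> N * wcost L <= r ->
  exists i d, let L' := Nat.iter i rot L in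
    i < length L /\
    X (pos (cyc L') (2 + d)) /\
    (forall e, e <= d -> sim (ginv (snd (cyc L' e))) (lval (cyc L' (S e)))) /\
    sim (lval (cyc L' 0)) (gmul (pos (cyc L') (2 + d)) (ginv (snd (cyc L' (S d))))).
Proof.
  intros HL HN Hgen Hone Hr. rewrite Forall_forall in Hgen.
  assert (Hlen : 0 < length L) by (destruct L; [easy|simpl; lia]).
  destruct (closed_word_return (cyc L)) with (m := N * length L)
    as [i [d [H1 [H2 H3]]]].
  - intros k. now apply Hgen, in_cyc.
  - intros k. now apply Hgen, in_cyc.
  - lia.
  - now rewrite pos_period.
  - now rewrite length_trail_period.
  - exists (i mod length L), d. cbv zeta. rewrite <- iter_rot_mod.
    unfold same_coset in H1. rewrite pos_shift, gmulKl in H1, H3.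
    rewrite !cyc_shift. split; [apply Nat.mod_upper_bound; lia|].
    split; [easy|]. split; [|easy]. intros e He. rewrite !cyc_shift. now apply H2.
Qed.

(** * Classes of neighbours *)

Hypothesis h_ne1 : h <> gone.
(** [N] will be [2 ^ (n - 1)]. The factor 8 below is the largest cost among the words used, reached
    for [g = t u t^-1]. *)
Variable N : nat.
Hypothesis N_pos : 0 < N.
Hypothesis N_r : 8 * N <= r.
Hypothesis comm_h_pow :
  forall g, gpow Gm (gmul (gmul (gmul h (ginv g)) h) g) N = gone.

(** A conjugate of [h] is not the identity, so if it lies in [X] it equals [h]. *)
Lemma X_conj_comm g : X (gmul g (gmul h (ginv g))) -> gmul h g = gmul g h.
Proof.
  intros [H|H].
  - exfalso. apply h_ne1. apply (gmul_injl _ g), (gmul_injr _ (ginv g)).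
    rewrite <- gmulA, H. now gnorm.
  - rewrite <- H at 1. now gnorm.
Qed.

Lemma X_conj_comm_inv g : X (gmul (ginv g) (gmul h g)) -> gmul h g = gmul g h.
Proof.
  intros H. rewrite <- (ginvK _ g) in H at 2. apply X_conj_comm in H.
  apply (gmul_injl _ (ginv g)), (gmul_injr _ (ginv g)).
  rewrite gmulA, <- H. now gnorm.
Qed.

Ltac unfold_word H :=
  cbv [Nat.iter nat_rect rot app cyc hd pos lval opt_h fst snd Nat.add] in H; gnorm_in H.

Lemma ginv_ne_h s : s <> h -> ginv s <> h.
Proof. intros H E. apply H. now rewrite <- (ginvK _ s), E, hV. Qed.

(** If [s] commutes with [h], the square [1, s, hs = sh, h] is the detour. Otherwise take a power of
    [h s^-1 h s]: the passage from [s^-1] to [h s] is the claim, and the only return without it,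
    [h s h s^-1], lies in [X] only if [s] commutes with [h]. *)
Lemma sim_hmul s : Gen s -> s <> h -> sim s (gmul h s).
Proof.
  intros Hs Hsh. destruct (classic (gmul h s = gmul s h)) as [Hc|Hc].
  - assert (E : sim (gmul (ginv gone) s) (gmul (ginv gone) (gmul h s))).
    { assert (HX : ~ X s) by (intros [-> | ->]; easy).
      apply (excursion_sim gone gone h [s; gmul h s]).
      - simpl. repeat split.
        + exists s. now gnorm.
        + exists h. now rewrite Hc.
        + apply cay_adj_sym. now exists s.
      - apply same_coset_refl.
      - right. now gnorm.
      - intros z [<-|[<-|[]]] H; unfold same_coset in H; gnorm_in H; [easy|].
        apply HX. generalize (X_mul h _ (or_intror eq_refl) H). now gnorm.
      - right. simpl. lia.
      - now left.
      - right; now left.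
      - exists gone. split; [apply same_coset_refl|]. exists s. now gnorm.
      - exists h. split; [right; now gnorm|now exists s]. }
    now gnorm_in E.
  - apply NNPP. intros Hns.
    destruct (cyclic_word_return [(true, ginv s); (true, s)] N)
      as [i [d [Hi [HX [Hnc _]]]]]; try easy.
    + repeat constructor; simpl; auto using ginv_ne_h.
    + rewrite <- (comm_h_pow s). f_equal. simpl. unfold lval. simpl. now gnorm.
    + simpl. lia.
    + destruct i as [|[|i]]; [| |simpl in Hi; lia].
      * specialize (Hnc 0 ltac:(lia)). now unfold_word Hnc.
      * destruct d as [|d].
        -- unfold_word HX. apply Hc, X_conj_comm.
           generalize (X_mul h _ (or_intror eq_refl) HX). now gnorm.
        -- specialize (Hnc 1 ltac:(lia)). now unfold_word Hnc.
Qed.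

Lemma sim_lval c : Gen (snd c) -> snd c <> h -> sim (lval c) (snd c).
Proof.
  intros H1 H2. unfold lval, opt_h. destruct (fst c).
  - apply sim_sym. now apply sim_hmul.
  - rewrite gmul1l. apply rt_refl.
Qed.

(** By [sim_hmul] a factor [h] before a generator does not change its class, so the optional
    [h]-edges and the element of [X] closing the return drop out. *)
Lemma cyclic_word_return_sim L :
  L <> [] -> Forall (fun c => Gen (snd c) /\ snd c <> h) L ->
  gpow _ (wprod L) N = gone -> N * wcost L <= r ->
  exists i d, let L' := Nat.iter i rot L in
    i < length L /\
    X (pos (cyc L') (2 + d)) /\
    (forall e, e <= d -> sim (ginv (snd (cyc L' e))) (snd (cyc L' (S e)))) /\
    sim (snd (cyc L' 0)) (ginv (snd (cyc L' (S d)))).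
Proof.
  intros HL Hgen Hone Hr.
  destruct (cyclic_word_return L N) as [i [d [Hi [HX [Hnc Hret]]]]]; auto.
  exists i, d. cbv zeta in *. set (L' := Nat.iter i rot L) in *.
  assert (Hg : forall k, Gen (snd (cyc L' k)) /\ snd (cyc L' k) <> h).
  { intros k. unfold L'. rewrite cyc_shift. rewrite Forall_forall in Hgen.
    now apply Hgen, in_cyc. }
  split; [easy|]. split; [easy|]. split.
  - intros e He. apply rt_trans with (lval (cyc L' (S e))); [auto|].
    apply sim_lval; apply Hg.
  - apply rt_trans with (lval (cyc L' 0)); [apply sim_sym, sim_lval; apply Hg|].
    eapply rt_trans; [exact Hret|].
    destruct HX as [-> | ->]; [rewrite gmul1l; apply rt_refl|].
    apply sim_sym, sim_hmul; [apply Gen_inv|apply ginv_ne_h]; apply Hg.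
Qed.

(** In powers of [h t^-1 t^-1 h t t] a passage between equal letters gives the claim. The only
    returns without one are [t^-1 h t] and [t h t^-1], which lie in [X] only if [t] commutes with
    [h]. *)
Lemma noncomm_sim_inv t :
  Gen t -> t <> h -> gmul h t <> gmul t h -> sim t (ginv t).
Proof.
  intros Ht Hth Hc. apply NNPP. intros Hns.
  assert (Hns' : ~ sim (ginv t) t) by (intros H; now apply Hns, sim_sym).
  destruct (cyclic_word_return_sim
              [(true, ginv t); (false, ginv t); (true, t); (false, t)])
    as [i [d [Hi [HX [Hnc _]]]]]; try easy.
  - repeat constructor; simpl; auto using ginv_ne_h.
  - rewrite <- (comm_h_pow (gmul t t)). f_equal. simpl. unfold lval. simpl.
    now gnorm.
  - simpl. lia.
  - destruct i as [|[|[|[|i]]]]; [| | | |simpl in Hi; lia].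
    + specialize (Hnc 0 ltac:(lia)). now unfold_word Hnc.
    + destruct d as [|d].
      * unfold_word HX. now apply Hc, X_conj_comm_inv.
      * specialize (Hnc 1 ltac:(lia)). now unfold_word Hnc.
    + specialize (Hnc 0 ltac:(lia)). now unfold_word Hnc.
    + destruct d as [|d].
      * unfold_word HX. now apply Hc, X_conj_comm.
      * specialize (Hnc 1 ltac:(lia)). now unfold_word Hnc.
Qed.

(* If the passage from [u] to [t^-1] does not cross, then [u] and [u^-1] are not
   similar, so [u] commutes with [h]; this excludes the return
   [u t^-1 h t u^-1]. *)
Lemma noncomm_sim_all t u :
  Gen t -> t <> h -> gmul h t <> gmul t h -> Gen u -> u <> h -> sim u t.
Proof.
  intros Ht Hth Hc Hu Huh. apply NNPP. intros Hns.
  assert (Ht' : sim t (ginv t)) by now apply noncomm_sim_inv.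
  assert (Hns1 : ~ sim u (ginv t)).
  { intros H. apply Hns. apply rt_trans with (ginv t); [easy|now apply sim_sym]. }
  assert (Hns2 : ~ sim t u) by (intros H; now apply Hns, sim_sym).
  assert (Hns3 : ~ sim (ginv t) u) by (intros H; now apply Hns1, sim_sym).
  destruct (cyclic_word_return_sim
              [(true, t); (false, ginv u); (false, ginv t);
               (true, t); (false, u); (false, ginv t)])
    as [i [d [Hi [HX [Hnc Hret]]]]]; try easy.
  - repeat constructor; simpl; auto using ginv_ne_h.
  - rewrite <- (comm_h_pow (gmul (gmul t u) (ginv t))). f_equal. simpl.
    unfold lval. simpl. now gnorm.
  - simpl. lia.
  (* Passages from [u^-1] to [t^-1] and from [t] to [u] are impossible by [Hns1] and [Hns3]. Of the
     returns avoiding both, [t^-1 h t] would make [t] commute with [h]; all others except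
     [u t^-1 h t u^-1] have end letters for which [Hret] contradicts the assumed dissimilarities. *)
  - destruct i as [|[|[|[|[|[|i]]]]]]; [| | | | | |simpl in Hi; lia].
    + destruct d as [|d]; [now unfold_word Hret|].
      specialize (Hnc 1 ltac:(lia)). now unfold_word Hnc.
    + specialize (Hnc 0 ltac:(lia)). now unfold_word Hnc.
    + destruct d as [|d].
      * unfold_word HX. now apply Hc, X_conj_comm_inv.
      * specialize (Hnc 1 ltac:(lia)). now unfold_word Hnc.
    + specialize (Hnc 0 ltac:(lia)). now unfold_word Hnc.
    + destruct d as [|[|[|d]]]; [now unfold_word Hret|now unfold_word Hret| |].
      * assert (Hcu : gmul h u = gmul u h).
        { apply NNPP. intros Hcu. pose proof (noncomm_sim_inv u Hu Huh Hcu) as Hu'.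
          specialize (Hnc 0 ltac:(lia)). unfold_word Hnc.
          apply Hns1. now apply rt_trans with (ginv u). }
        unfold_word HX. apply Hc, X_conj_comm_inv.
        (* Conjugation by [u] fixes [h], so membership in [X] passes from [u t^-1 h t u^-1] to
           [t^-1 h t]. *)
        destruct HX as [HX|HX]; [left|right];
          apply (gmul_injl _ u), (gmul_injr _ (ginv u)); gnorm; rewrite HX.
        -- now gnorm.
        -- rewrite gmulA, <- Hcu. now gnorm.
      * specialize (Hnc 3 ltac:(lia)). now unfold_word Hnc.
    + destruct d as [|[|d]]; [|now unfold_word Hret|].
      * unfold_word HX. now apply Hc, X_conj_comm_inv.
      * specialize (Hnc 2 ltac:(lia)). now unfold_word Hnc.
Qed.

Lemma nbhd_sim_gen a :
  nbhd Gm (cay_adj Gen) gone h a -> exists s, Gen s /\ s <> h /\ sim a s.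
Proof.
  intros [Ha [x [Hx [s [Hs ->]]]]]. exists s. split; [easy|].
  assert (Hsh : s <> h).
  { intros ->. apply Ha. apply X_mul; [easy|now right]. }
  split; [easy|]. destruct Hx as [-> | ->].
  - rewrite gmul1l. apply rt_refl.
  - now apply sim_sym, sim_hmul.
Qed.

Lemma gen_commutes_h a b s :
  nbhd Gm (cay_adj Gen) gone h a -> nbhd Gm (cay_adj Gen) gone h b -> ~ sim a b ->
  Gen s -> gmul h s = gmul s h.
Proof.
  intros Ha Hb Hab Hs. apply NNPP. intros Hc.
  assert (Hsh : s <> h) by (intros ->; now apply Hc).
  destruct (nbhd_sim_gen a Ha) as [u [Hu [Huh Hau]]].
  destruct (nbhd_sim_gen b Hb) as [v [Hv [Hvh Hbv]]].
  apply Hab. apply rt_trans with u; [easy|].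
  apply rt_trans with s; [now apply noncomm_sim_all|].
  apply rt_trans with v; [|now apply sim_sym].
  apply sim_sym. now apply noncomm_sim_all.
Qed.

End CayleyWalks.

(** * Iterated commutators with an involution, and normality *)

Lemma comm_iter_involution (Gm : group) (h g : Gm) k :
  gmul h h = gone ->
  comm_iter h g k = gpow _ (gmul (gmul (gmul h (ginv g)) h) g) (2 ^ k).
Proof.
  intros hh. pose proof (hV _ _ hh) as HV. pose proof (hhK _ _ hh) as HK.
  (* The induction also carries that conjugation by [h] inverts [c = comm_iter h g k]; hence the
     next commutator [h c^-1 h^-1 c] is the square of [c]. *)
  enough (H : comm_iter h g k = gpow _ (gmul (gmul (gmul h (ginv g)) h) g) (2 ^ k) /\
              gmul (gmul h (ginv (comm_iter h g k))) h = comm_iter h g k) by apply H.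
  induction k as [|k [IH1 IH2]].
  - simpl. split; repeat (progress autorewrite with grp || rewrite HV || rewrite hh); easy.
  - simpl comm_iter. set (c := comm_iter h g k) in *. rewrite HV, IH2. split.
    + rewrite IH1. simpl. now rewrite gpowD, Nat.add_0_r.
    + rewrite <- IH2 at 3 4. autorewrite with grp. now rewrite HK.
Qed.

Theorem theorem6p3 (Gm : group) (n : nat) (S : Gm -> Prop) (r : nat) (h : Gm) :
  1 <= n ->
  nilpotent_le Gm n ->
  generating_set S ->
  ~ S gone ->
  2 ^ (n + 2) <= r -> 10 <= r ->
  S h ->
  local_2_separator Gm (cay_adj S) r gone h ->
  (forall v : Gm, ~ local_cutvertex Gm (cay_adj S) r v) ->
  involution h ->
  normal (generated (fun x : Gm => x = h)).
Proof.
  intros Hn Hnil [Sinv Sgen] S1 Hr _ Sh [[a [b [Ha [Hb Hab]]]] _] _ [hh h1].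
  assert (Hpow : forall g, gpow Gm (gmul (gmul (gmul h (ginv g)) h) g) (2 ^ (n - 1)) = gone).
  (* The nilpotency hypothesis leaves out [g = h] and [g = h^-1]; there the base word is already
     trivial. *)
  { intros g. destruct (classic (gequiv h g)) as [E|E].
    - rewrite <- (gpow1n Gm (2 ^ (n - 1))). f_equal.
      destruct E as [<-|E].
      + now rewrite gmulVr, gmul1l.
      + now rewrite <- E, hh, gmul1l, E, gmulVl.
    - rewrite <- comm_iter_involution by easy. now apply Hnil. }
  assert (HS : forall s, S s -> gmul h s = gmul s h).
  { intros s. apply (gen_commutes_h Gm S r h) with (N := 2 ^ (n - 1)) (a := a) (b := b); auto.
    - pose proof (Nat.pow_nonzero 2 (n - 1)). lia.
    (* Here [2 ^ (n + 2)] is eight times [2 ^ (n - 1)]. *)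
    - replace (n + 2) with (3 + (n - 1)) in Hr by lia.
      rewrite Nat.pow_add_r in Hr. simpl in Hr. simpl. lia. }
  assert (Hcent : forall g, gmul h g = gmul g h).
  { intros g. induction (Sgen g) as [x Hx| |x y _ IHx _ IHy|x _ IHx].
    - auto.
    - now rewrite gmul1l, gmul1r.
    - now rewrite gmulA, IHx, <- !gmulA, IHy.
    - apply (gmul_injl _ x), (gmul_injr _ x).
      rewrite gmulA, <- IHx. now autorewrite with grp. }
  intros g x Hx.
  replace (gmul (gmul g x) (ginv g)) with x; [easy|].
  (* As [h] is central, so is every element of the subgroup it generates, and conjugation fixes
     it. *)
  assert (E : gmul x g = gmul g x).
  { induction Hx as [x ->| |x y _ IHx _ IHy|x _ IHx].
    - auto.
    - now rewrite gmul1l, gmul1r.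
    - now rewrite <- gmulA, IHy, !gmulA, IHx.
    - apply (gmul_injl _ x), (gmul_injr _ x).
      rewrite (gmulA _ x g), IHx. now autorewrite with grp. }
  rewrite <- E. now autorewrite with grp.
Qed.
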